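(* Let $X$ be a determinantal random subset of $S$ associated with the subspace $\operatorname{im} d$ in the orthonormal basis $(e_i^\star/\sqrt{x_i})_{i\in S}$ of $E^*$. For all $T\in\mathcal B(\mathcal M)$, $$\mathbb P(X=T)=\frac{\underline x^{-T^c}}{\|\mathscr Z_T\|^2}.$$
   Context: Let $\mathbb K=\mathbb R$ or $\mathbb C$, $S=\{1,\dots,s\}$, $E$ an $s$-dimensional $\mathbb K$-vector space with basis $(e_i)_{i\in S}$, $F$ a finite-dimensional $\mathbb K$-vector space, and $\partial:E\to F$ a linear map. Let $\mathcal M$ be the linear matroid on $S$ whose independent sets are the $I\subseteq S$ such that $\{\partial(e_i):i\in I\}$ is linearly independent; $\mathcal B(\mathcal M)$ is its set of bases; $Z=\ker\partial$. For $J\subseteq S$, $E_J=\mathrm{Vect}(e_j:j\in J)$ and $J^c=S\setminus J$. For $T\in\mathcal B(\mathcal M)$ one has $E=E_T\oplus Z$; $\mathsf Z_T:E\to Z$ is the corresponding projection, and $\mathscr Z_T=(\mathsf Z_T(e_j):j\in T^c)$, ordered by the order of $S$, is a basis of $Z$. The dual spaces $E^*$ and $F^*$ are inner product spaces (antilinear in the first variable), and the dual basis $(e_i^\star)_{i\in S}$ of $E^*$ is orthogonal, with $\langle e_i^\star,e_j^\star\rangle=x_i\delta_{ij}$ for positive weights $(x_i)_{i\in S}$; $\underline x^I=\prod_{i\in I}x_i$ and $\underline x^{-I}=(\underline x^I)^{-1}$. $d:F^*\to E^*$ is the transpose of $\partial$. $J_{\underline x}:E\to E^*$ is the antilinear isomorphism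 with $J_{\underline x}(e_i)=x_i^{-1}e_i^\star$. For a basis $\mathscr B=(f_1,\dots,f_r)$ of a subspace of $E$, $\|\mathscr B\|^2=\det(\langle J_{\underline x}f_i,J_{\underline x}f_j\rangle)_{1\le i,j\le r}$. Given a finite-dimensional inner product space with an orthonormal basis indexed by a finite set $S$ and a subspace $H$, a random subset $X$ of $S$ is determinantal associated to $H$ in this basis if $\mathbb P(J\subseteq X)=\det((\Pi^H)^J_J)$ for all $J\subseteq S$, where $\Pi^H$ is the orthogonal projection on $H$ and $(\Pi^H)^J_J$ is the submatrix of its matrix in the basis with rows and columns in $J$. *)

(* Defs.v *)
From HB Require Import structures.
From mathcomp Require Import all_boot all_order all_algebra.
From mathcomp Require Import complex.
From mathcomp Require Import all_classical all_reals all_analysis.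

Set Implicit Arguments.
Unset Strict Implicit.
Unset Printing Implicit Defensive.

Import Order.TTheory GRing.Theory Num.Theory.

Local Open Scope ring_scope.

(* The base field: the reals R or the complex numbers R[i]. *)
Inductive field_kind := RealField | ComplexField.

Definition scalars (R : realType) (k : field_kind) : numFieldType :=
  match k with
  | RealField => (R : numFieldType)
  | ComplexField => (R[i] : numFieldType)
  end.

Definition of_real (R : realType) (k : field_kind) : R -> scalars R k :=
  match k return R -> scalars R k with
  | RealField => idfun
  | ComplexField => fun r => (r%:C)%C
  end.
Arguments of_real {R k}.

Definition conjK (R : realType) (k : field_kind) :
    scalars R k -> scalars R k :=
  match k return scalars R k -> scalars R k with
  | RealField => idfun
  | ComplexField => @conjc R
  end.
Arguments conjK {R k}.

Section ConjInstances.
Variables (R : realType) (k : field_kind).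

Fact conjK_is_zmod_morphism : zmod_morphism (@conjK R k).
Proof. by case: k => x y //=; rewrite raddfB. Qed.

Fact conjK_is_monoid_morphism : monoid_morphism (@conjK R k).
Proof.
by case: k => /=; split => //; [exact: rmorph1 | exact: rmorphM].
Qed.

Fact conjK_involutive : involutive (@conjK R k).
Proof. by case: k => x //=; rewrite conjcK. Qed.

HB.instance Definition _ :=
  GRing.isZmodMorphism.Build _ _ (@conjK R k) conjK_is_zmod_morphism.
HB.instance Definition _ :=
  GRing.isMonoidMorphism.Build _ _ (@conjK R k) conjK_is_monoid_morphism.
HB.instance Definition _ := isInvolutive.Build _ (@conjK R k) conjK_involutive.
End ConjInstances.

Section LinearMatroid.
Variables (K : fieldType) (s : nat) (E F : vectType K).
Variables (e : s.-tuple E) (del : 'Hom(E, F)).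

(* Linear independence is that of the family (del e_i)_(i in I): two distinct
   indices with the same image are dependent. *)
Definition matroid_indep (I : {set 'I_s}) : bool :=
  free [seq del (tnth e i) | i <- enum I].

Definition matroid_basis (T : {set 'I_s}) : bool := maxset matroid_indep T.

Definition coord_subspace (J : {set 'I_s}) : {vspace E} :=
  <<[seq tnth e j | j <- enum J]>>%VS.

(* The projection onto ker del along E_T. *)
Definition kernel_proj (T : {set 'I_s}) : 'End(E) :=
  daddv_pi (lker del) (coord_subspace T).

Definition kernel_basis (T : {set 'I_s}) : seq E :=
  [seq kernel_proj T (tnth e j) | j <- enum (~: T)].

End LinearMatroid.

Section Duality.
Variables (K : fieldType) (E : vectType K).

Definition dual : vectType K := 'Hom(E, K^o).

Definition dual_vect (s : nat) (e : s.-tuple E) (i : 'I_s) : dual :=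
  linfun (coord e i : E -> K^o).

End Duality.

Section Transpose.
Variables (K : fieldType) (E F : vectType K) (del : 'Hom(E, F)).

Definition precomp (phi : dual F) : dual E := (phi \o del)%VF.

Fact precomp_is_linear : linear precomp.
Proof.
by move=> a u v; rewrite /precomp (comp_lfunDl (a *: u)) comp_lfunZl.
Qed.

HB.instance Definition _ :=
  GRing.isLinear.Build K (dual F) (dual E) _ precomp precomp_is_linear.

Definition transpose : 'Hom(dual F, dual E) := linfun precomp.

End Transpose.

(* The library's forms are linear in the first variable and semilinear in the
   second, whereas the inner products here are antilinear in the first one. *)
Definition inner (R : realType) (k : field_kind) (V : vectType (scalars R k))
  (dotV : {dot V for (@conjK R k)}) (u v : V) : scalars R k := dotV v u.

Section Determinantal.
Variables (R : realType) (k : field_kind).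
Local Notation K := (scalars R k).
Variables (V : vectType K) (dotV : {dot V for (@conjK R k)}).

Definition orth_proj (H : {vspace V}) : 'End(V) :=
  daddv_pi H (orthov dotV H).

Definition coord_mx (n : nat) (b : n.-tuple V) (p : 'End(V)) : 'M[K]_n :=
  \matrix_(i, j) coord b i (p (tnth b j)).

Definition principal_submx (n : nat) (M : 'M[K]_n) (J : {set 'I_n}) :
    'M[K]_#|J| :=
  mxsub (fun i : 'I_#|J| => enum_val i) (fun i : 'I_#|J| => enum_val i) M.

Definition determinantal (d : measure_display) (Om : measurableType d)
    (P : probability Om R) (n : nat) (b : n.-tuple V) (H : {vspace V})
    (X : Om -> {set 'I_n}) : Prop :=
  (forall J : {set 'I_n}, measurable [set w | X w = J]%classic) /\
  (forall J : {set 'I_n},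
     of_real (fine (P [set w | J \subset X w]%classic)) =
     \det (principal_submx (coord_mx b (orth_proj H)) J)).

End Determinantal.

Section Weights.
Variables (R : realType) (k : field_kind).
Local Notation K := (scalars R k).
Variables (s : nat) (E : vectType K) (e : s.-tuple E) (x : 'I_s -> R).
Variable dotE : {dot dual E for (@conjK R k)}.

Definition weight (I : {set 'I_s}) : R := \prod_(i in I) x i.

(* The antilinear map with J_x(e_i) = x_i^-1 e_i^*. *)
Definition Jx (v : E) : dual E :=
  \sum_(i < s) (conjK (coord e i v) * of_real (x i)^-1) *: dual_vect e i.

Definition basis_sqnorm (B : seq E) : K :=
  \det (\matrix_(i < size B, j < size B) inner dotE (Jx B`_i) (Jx B`_j)).

Definition normalized_dual_basis : s.-tuple (dual E) :=
  [tuple of_real (Num.sqrt (x i))^-1 *: dual_vect e i | i < s].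

Lemma normalized_dual_basisP :
    basis_of fullv e -> (forall i, 0 < x i) ->
    (forall i j, inner dotE (dual_vect e i) (dual_vect e j) =
                 of_real (x i) *+ (i == j)) ->
  basis_of fullv normalized_dual_basis /\
  (forall i j, inner dotE (tnth normalized_dual_basis i)
                          (tnth normalized_dual_basis j) = (i == j)%:R).
Proof.
move=> e_basis x_gt0 dotE_dual.
have of_realM (a b : R) : of_real (a * b) = of_real a * of_real b :> K.
  by case: (k) => //=; rewrite rmorphM.
have of_real1 : of_real 1 = 1 :> K by case: (k).
have conj_real (a : R) : conjK (of_real a) = of_real a :> K.
  by case: (k) => //=; rewrite oppr0.
have orth i j : inner dotE (tnth normalized_dual_basis i)
                          (tnth normalized_dual_basis j) = (i == j)%:R.
  rewrite !tnth_mktuple /inner linearZl linearZr /=.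
  rewrite conj_real -[dotE _ _]/(inner dotE _ _) dotE_dual.
  case: eqP => [<-|_]; last by rewrite !mulr0n !mulr0.
  have sqrt_neq0 : Num.sqrt (x i) != 0 by rewrite gt_eqF // sqrtr_gt0.
  rewrite !mulr1n -!of_realM -of_real1; congr of_real.
  set r := Num.sqrt (x i) in sqrt_neq0 *.
  have -> : x i = r * r by rewrite -expr2 sqr_sqrtr // ltW.
  by rewrite mulKf // mulVf.
have bE i := tnth_mktuple
  (fun i => of_real (Num.sqrt (x i))^-1 *: dual_vect e i) i.
rewrite -/normalized_dual_basis in bE.
move: normalized_dual_basis orth bE => b orth bE.
split=> //; rewrite /basis_of eqEsubv subvf /=; apply/andP; split.
  apply/subvP => phi _.
  have -> : phi = \sum_(i < s) (phi (tnth e i) * of_real (Num.sqrt (x i))) *: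
                    tnth b i.
    apply/lfunP => v; rewrite sum_lfunE.
    rewrite {1}(coord_basis e_basis (memvf v)) linear_sum /=.
    apply: eq_bigr => i _; rewrite linearZ scale_lfunE bE scale_lfunE.
    rewrite scalerA -mulrA -of_realM divff ?gt_eqF ?sqrtr_gt0 // of_real1.
    by rewrite mulr1 /dual_vect lfunE /= -tnth_nth /GRing.scale /= mulrC.
  by apply: memv_suml => i _; apply: memvZ; apply: memv_span; apply: mem_tnth.
apply/freeP => c c0 j; move/(congr1 (inner dotE (tnth b j))): c0.
rewrite /inner linear0l linear_sumlz (bigD1 j) //= big1 ?addr0 => [|i ij].
  rewrite linearZl /= -tnth_nth -[dotE _ _]/(inner dotE _ _) orth eqxx.
  by rewrite mulr1.
rewrite linearZl /= -tnth_nth -[dotE _ _]/(inner dotE _ _) orth eq_sym.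
by rewrite (negPf ij) mulr0.
Qed.

End Weights.

(* Main.v *)
From HB Require Import structures.
Require Import Defs.
From mathcomp Require Import all_boot all_order all_algebra.
From mathcomp Require Import complex.
From mathcomp Require Import all_classical all_reals all_analysis.

Set Implicit Arguments.
Unset Strict Implicit.
Unset Printing Implicit Defensive.

Import Order.TTheory GRing.Theory Num.Theory.

Local Open Scope ring_scope.

(* Write [z_l = Z_T(e_l)] for [l] outside [T], [g_l = J_x(z_l)], [b] for the
   normalized dual basis and [M] for the matrix of the projection on [im d].
   The [g_l] span the orthogonal complement of [im d], because [<J_x v, phi>]
   is [phi(v)].  Hence, with [G] the coordinate matrix of the [g_l],
   [1 - M = G C] for some [C] and [G^* M = 0], so that [G^* G C = G^*].
   Sylvester's identity applied to the block on [T] gives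
     det(G^* G) det(M_T) = det(G^* G - G_T^* G_T) = det(G_{T^c}^* G_{T^c}),
   where [G^* G] is the Gram matrix of the [g_l] and [G_{T^c}] is the diagonal
   matrix of the [x_l^(-1/2)].  Finally [P(X = T) = P(T \subset X)], because for
   [l] outside [T] the vector [g_l] is supported in [l |: T] and its conjugate
   is in the left kernel of [M], so that [X] a.s. does not contain [l |: T]. *)

(** * Determinant identities over a commutative ring *)

Lemma det_sub1_mulmxC (K : comNzRingType) (m n : nat) (A : 'M[K]_(m, n))
    (B : 'M[K]_(n, m)) : \det (1%:M - A *m B) = \det (1%:M - B *m A).
Proof.
(* The matrix with off-diagonal blocks [A] and [B] is multiplied on either side by one lower
   unitriangular matrix; both products are block upper triangular, and their determinants agree by
   commutativity. *)
have E1 : block_mx 1%:M A B 1%:M *m block_mx 1%:M 0 (- B) 1%:M =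
          block_mx (1%:M - A *m B) A 0 1%:M.
  rewrite mulmx_block !mulmx1 !mulmx0 ?mul1mx !mulmxN.
  by rewrite subrr !add0r.
have E2 : block_mx 1%:M 0 (- B) 1%:M *m block_mx 1%:M A B 1%:M =
          block_mx 1%:M A 0 (1%:M - B *m A).
  rewrite mulmx_block !mulmx1 ?mul0mx ?mul1mx ?mulNmx !addr0.
  by rewrite addNr addrC.
have := congr1 determinant E1; have := congr1 determinant E2.
by rewrite !det_mulmx !det_ublock !det1 mul1r mulr1 mulrC => -> ->.
Qed.

Lemma sum_set_enum_val (V : nmodType) (s : nat) (T : {set 'I_s})
    (h : 'I_s -> V) :
  \sum_i h i =
  \sum_(i < #|T|) h (enum_val i) + \sum_(i < #|~: T|) h (enum_val i).
Proof.
rewrite -!(big_enum_val h) (bigID (mem T)) /=; congr (_ + _).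
by apply: eq_bigl => i; rewrite inE.
Qed.

Lemma mulmx_colsub_rowsub (K : nzRingType) (s m n : nat) (T : {set 'I_s})
    (A : 'M[K]_(m, s)) (B : 'M[K]_(s, n)) :
  A *m B = colsub (fun i : 'I_#|T| => enum_val i) A *m
             rowsub (fun i : 'I_#|T| => enum_val i) B +
           colsub (fun i : 'I_#|~: T| => enum_val i) A *m
             rowsub (fun i : 'I_#|~: T| => enum_val i) B.
Proof.
apply/matrixP => i j; rewrite !mxE (sum_set_enum_val T).
by congr (_ + _); apply: eq_bigr => l _; rewrite !mxE.
Qed.

(* [Gs] plays the role of the adjoint of [G]; the hypotheses hold when [M] is
   the projection on the kernel of [Gs] along the column space of [G]. *)
Lemma det_gram_mul_det_projection (K : comNzRingType) (s m : nat)
    (T : {set 'I_s}) (M : 'M[K]_s) (G : 'M[K]_(s, m)) (C Gs : 'M[K]_(m, s)) :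
  1%:M - M = G *m C -> Gs *m M = 0 ->
  \det (Gs *m G) *
    \det (mxsub (fun i : 'I_#|T| => enum_val i)
                (fun i : 'I_#|T| => enum_val i) M) =
  \det (colsub (fun i : 'I_#|~: T| => enum_val i) Gs *m
        rowsub (fun i : 'I_#|~: T| => enum_val i) G).
Proof.
move=> MGC GsM; set f := fun i : 'I_#|T| => enum_val i.
have NC : Gs *m G *m C = Gs by rewrite -mulmxA -MGC mulmxBr mulmx1 GsM subr0.
have -> : mxsub f f M = 1%:M - rowsub f G *m colsub f C.
  rewrite -mxsub_mul -MGC; apply/matrixP => i j; rewrite !mxE.
  by rewrite (inj_eq enum_val_inj) opprB addrC subrK.
(* Sylvester's identity brings the second determinant to size [m], where the two factors merge into
   a single determinant and [Gs *m G] need not be inverted. *)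
rewrite det_sub1_mulmxC -det_mulmx mulmxBr mulmx1 mulmxA.
have -> : Gs *m G *m colsub f C = colsub f Gs.
  by rewrite mulmx_colsub NC.
by congr (\det _); rewrite (mulmx_colsub_rowsub T) addrC addKr.
Qed.

(** * The splitting of [E] by a matroid basis, and the resulting basis of the kernel *)

Section KernelBasis.
Variables (K : fieldType) (s : nat) (E F : vectType K).
Variables (e : s.-tuple E) (del : 'Hom(E, F)).
Implicit Types (J T : {set 'I_s}).

Lemma mem_coord_subspace J i : i \in J -> tnth e i \in coord_subspace e J.
Proof. by move=> iJ; apply/memv_span/map_f; rewrite mem_enum. Qed.

Lemma coord_tnth (e_basis : basis_of fullv e) i j :
  coord e i (tnth e j) = (i == j)%:R.
Proof.
by rewrite (tnth_nth 0) coord_free ?(basis_free e_basis) // eq_sym.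
Qed.

Lemma coord_coord_subspace (e_basis : basis_of fullv e) J v i :
  v \in coord_subspace e J -> i \notin J -> coord e i v = 0.
Proof.
move=> vJ iJ.
have /subvP/(_ _ vJ) :
    (coord_subspace e J <= lker (linfun (coord e i : E -> K^o)))%VS.
  apply/span_subvP => u /mapP[j]; rewrite mem_enum => jJ ->.
  rewrite memv_ker lfunE /= coord_tnth //; case: (i =P j) => // ij.
  by rewrite ij jJ in iJ.
by rewrite memv_ker lfunE /= => /eqP.
Qed.

(** Rank-nullity: by independence the image of [coord_subspace e T] has dimension [#|T|], which
    already bounds the dimension of the source. *)
Lemma matroid_indep_cap T :
  matroid_indep e del T -> (lker del :&: coord_subspace e T = 0)%VS.
Proof.
move=> Tfree; apply/eqP; rewrite -dimv_eq0 capvC -leqn0.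
rewrite -(leq_add2r (\dim (del @: coord_subspace e T))) limg_ker_dim add0n.
rewrite limg_span -map_comp (eqnP Tfree) size_map.
by apply: leq_trans (dim_span _) _; rewrite size_map.
Qed.

(** By maximality, for [j] outside [T] the vector [del e_j] is some [del t] with [t] in the span of
    the [e_i], [i] in [T]; then [e_j - t] lies in the kernel. *)
Lemma matroid_basis_add (e_basis : basis_of fullv e) T :
  matroid_basis e del T -> (lker del + coord_subspace e T = fullv)%VS.
Proof.
move=> /maxsetP[Tindep Tmax]; apply/eqP; rewrite eqEsubv subvf /=.
rewrite -(span_basis e_basis); apply/span_subvP => _ /tnthP[j ->].
have [jT|jT] := boolP (j \in T).
  by apply: (subvP (addvSr _ _)); apply: mem_coord_subspace.
have : ~~ matroid_indep e del (j |: T).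
  apply/negP => /Tmax/(_ (finset.subsetUr _ _)) eqT.
  by rewrite -eqT finset.setU11 in jT.
rewrite /matroid_indep.
have /perm_free -> : perm_eq [seq del (tnth e i) | i <- enum (j |: T)]
                             [seq del (tnth e i) | i <- j :: enum T].
  apply: perm_map; apply: uniq_perm; rewrite ?enum_uniq //=.
    by rewrite mem_enum jT enum_uniq.
  by move=> i; rewrite in_cons !mem_enum in_setU1.
rewrite /= free_cons [free _]Tindep andbT negbK.
rewrite (map_comp del (tnth e)) -limg_span => /memv_imgP[t tT dt].
rewrite -(subrK t (tnth e j)); apply: memv_add => //.
by rewrite memv_ker linearB /= dt subrr.
Qed.

Lemma kernel_proj_ker T v : kernel_proj e del T v \in lker del.
Proof. exact: memv_pi. Qed.

Hypothesis e_basis : basis_of fullv e.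
Variable T : {set 'I_s}.
Hypothesis T_basis : matroid_basis e del T.

Lemma sub_kernel_proj v : v - kernel_proj e del T v \in coord_subspace e T.
Proof.
have Tcap := matroid_indep_cap (maxsetp T_basis).
have := daddv_pi_add (w := v) Tcap.
rewrite matroid_basis_add // memvf => /(_ isT) eq_v.
by rewrite -[X in X - _]eq_v [X in X - _]addrC addrK memv_pi.
Qed.

Lemma coord_kernel_proj i v : i \notin T ->
  coord e i (kernel_proj e del T v) = coord e i v.
Proof.
move=> iT; apply/eqP; rewrite eq_sym -subr_eq0 -linearB /=.
by rewrite (coord_coord_subspace e_basis (sub_kernel_proj v)).
Qed.

Lemma kernel_proj0 i : i \in T -> kernel_proj e del T (tnth e i) = 0.
Proof.
move=> iT; apply/eqP; rewrite -memv0 -(matroid_indep_cap (maxsetp T_basis)).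
rewrite memv_cap kernel_proj_ker -(subKr (tnth e i) (kernel_proj e del T _)).
by rewrite memvB ?sub_kernel_proj ?mem_coord_subspace.
Qed.

(** Apply the projection to the expansion of [v] in [e]: it fixes [v] and kills the terms indexed by
    [T]. *)
Lemma kernel_expansion v : v \in lker del ->
  v = \sum_(j < #|~: T|) coord e (enum_val j) v *:
        kernel_proj e del T (tnth e (enum_val j)).
Proof.
move=> vZ.
rewrite -{1}(daddv_pi_id (matroid_indep_cap (maxsetp T_basis)) vZ).
rewrite -/(kernel_proj e del T) {1}(coord_basis e_basis (memvf v)).
rewrite linear_sum /=.
rewrite (sum_set_enum_val T) big1 ?add0r => [|i _].
  by apply: eq_bigr => i _; rewrite linearZ /= -tnth_nth.
by rewrite linearZ /= -tnth_nth kernel_proj0 ?scaler0 // enum_valP.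
Qed.

End KernelBasis.

(** * Embedding of the real scalars as a ring morphism *)

Section OfReal.
Variables (R : realType) (k : field_kind).

Fact of_real_is_zmod_morphism : zmod_morphism (@of_real R k).
Proof. by case: k => a b //; exact: (rmorphB (real_complex R)). Qed.

Fact of_real_is_monoid_morphism : monoid_morphism (@of_real R k).
Proof. by case: k; split => //= a b; rewrite rmorphM. Qed.

HB.instance Definition _ :=
  GRing.isZmodMorphism.Build R (scalars R k) (@of_real R k)
    of_real_is_zmod_morphism.
HB.instance Definition _ :=
  GRing.isMonoidMorphism.Build R (scalars R k) (@of_real R k)
    of_real_is_monoid_morphism.

Lemma conjK_of_real a : conjK (of_real a) = of_real a :> scalars R k.
Proof. by case: k => //=; rewrite oppr0. Qed.

End OfReal.

(** * Orthogonal complements and projections *)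

Section OrthogonalProjection.
Variables (R : realType) (k : field_kind).
Local Notation K := (scalars R k).
Variables (V : vectType K) (dotV : {dot V for (@conjK R k)}).
Implicit Types (H : {vspace V}).

Lemma orthov_cap H : (H :&: orthov dotV H = 0)%VS.
Proof.
apply/eqP; rewrite -subv0; apply/subvP => u; rewrite memv_cap memv0.
case/andP=> uH /mem_orthovP/(_ u uH) uu0.
by apply/negP => /negP/(neq0_dnorm_gt0 (s := dotV)); rewrite uu0 ltxx.
Qed.

(** Dimension count: the complement contains the kernel of the map sending [v] to its products with
    a basis of [H], and the rank of that map is at most [\dim H]. *)
Lemma orthov_add H : (H + orthov dotV H = fullv)%VS.
Proof.
apply/eqP; rewrite eqEdim subvf dimv_disjoint_sum ?orthov_cap //=.
pose f v : 'rV[K]_(\dim H) := \row_i dotV v (vbasis H)`_i.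
have f_linear : linear f.
  by move=> a u v; apply/rowP => i; rewrite !mxE linearPl.
pose fL := GRing.isLinear.Build K V 'rV[K]_(\dim H) _ f f_linear.
pose g : 'Hom(V, 'rV[K]_(\dim H)) :=
  linfun (HB.pack_for {linear V -> 'rV[K]_(\dim H)} f fL).
rewrite -(limg_ker_dim g fullv) capfv addnC leq_add //.
  by apply: leq_trans (dimvS (subvf _)) _; rewrite dimvf /dim /= mul1n.
apply: dimvS; apply/subvP => u; rewrite memv_ker lfunE /= => /eqP/rowP fu0.
apply/mem_orthovP => v /coord_vbasis ->.
rewrite linear_sumr big1 // => i _; rewrite linearZr /=.
by have := fu0 i; rewrite !mxE => ->; rewrite mulr0.
Qed.

Lemma orth_proj_mem H v : orth_proj dotV H v \in H.
Proof. exact: memv_pi. Qed.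

Lemma sub_orth_proj H v : v - orth_proj dotV H v \in orthov dotV H.
Proof.
have := daddv_pi_add (w := v) (orthov_cap H).
rewrite orthov_add memvf => /(_ isT) eq_v.
by rewrite -[X in X - _]eq_v [X in X - _]addrC addrK memv_pi.
Qed.

Lemma inner_expansion n (b : n.-tuple V) (b_basis : basis_of fullv b) u v :
  inner dotV u v = \sum_i coord b i v * inner dotV u (tnth b i).
Proof.
rewrite {1}(coord_basis b_basis (memvf v)) /inner linear_sumlz.
by apply: eq_bigr => i _; rewrite linearZl_LR /= -tnth_nth.
Qed.

End OrthogonalProjection.

(** * The antilinear map [J] as the inverse of the Riesz isomorphism *)

Section AntilinearIsomorphism.
Variables (R : realType) (k : field_kind) (s : nat).
Local Notation K := (scalars R k).
Variables (E : vectType K) (e : s.-tuple E) (x : 'I_s -> R).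
Hypotheses (e_basis : basis_of fullv e) (x_gt0 : forall i, 0 < x i).
Local Notation J := (Jx e x).
Local Notation b := (normalized_dual_basis e x).

Lemma of_realMV i : of_real (x i) * of_real (x i)^-1 = 1 :> K.
Proof. by rewrite -rmorphM divff ?rmorph1 // gt_eqF. Qed.

Lemma dual_vectE i v : dual_vect e i v = coord e i v.
Proof. exact: lfunE. Qed.

Lemma dual_vect_expansion (phi : dual E) :
  phi = \sum_i phi (tnth e i) *: dual_vect e i.
Proof.
apply/lfunP => v; rewrite sum_lfunE.
rewrite {1}(coord_basis e_basis (memvf v)) linear_sum /=.
apply: eq_bigr => i _; rewrite linearZ scale_lfunE dual_vectE -tnth_nth.
exact: mulrC.
Qed.

Lemma Jx_sum n (c : 'I_n -> K) (z : 'I_n -> E) :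
  J (\sum_l c l *: z l) = \sum_l conjK (c l) *: J (z l).
Proof.
under [RHS]eq_bigr do rewrite scaler_sumr.
rewrite exchange_big; apply: eq_bigr => i _ /=.
rewrite linear_sum rmorph_sum mulr_suml scaler_suml.
by apply: eq_bigr => l _; rewrite linearZ rmorphM scalerA mulrA.
Qed.

Lemma Jx_surj (phi : dual E) :
  J (\sum_i (conjK (phi (tnth e i)) * of_real (x i)) *: tnth e i) = phi.
Proof.
rewrite [RHS]dual_vect_expansion; apply: eq_bigr => i _; congr (_ *: _).
under eq_bigr do rewrite (tnth_nth 0).
rewrite coord_sum_free ?(basis_free e_basis) // rmorphM /= conjK_of_real.
by rewrite conjK_involutive -mulrA of_realMV mulr1 -tnth_nth.
Qed.

Lemma coord_Jx i v : basis_of fullv b ->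
  coord b i (J v) = conjK (coord e i v) * of_real (Num.sqrt (x i))^-1.
Proof.
move=> b_basis.
have -> : J v =
    \sum_j (conjK (coord e j v) * of_real (Num.sqrt (x j))^-1) *: b`_j.
  apply: eq_bigr => j _; rewrite -tnth_nth tnth_mktuple scalerA; congr (_ *: _).
  rewrite -mulrA -rmorphM -invfM -expr2 sqr_sqrtr //.
  exact: ltW.
by rewrite coord_sum_free ?(basis_free b_basis).
Qed.

Variable dotE : {dot dual E for (@conjK R k)}.
Hypothesis dotE_dual : forall i j,
  inner dotE (dual_vect e i) (dual_vect e j) = of_real (x i) *+ (i == j).

(** The factor [x_i^-1] in [J] cancels the squared norm of [e_i^*], and the conjugation cancels the
    antilinearity of the first variable. Orthogonality to [J v] thus becomes vanishing at [v]. *)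
Lemma inner_Jx v (phi : dual E) : inner dotE (J v) phi = phi v.
Proof.
rewrite /inner linear_sumr /= [X in _ = phi X](coord_basis e_basis (memvf v)).
rewrite linear_sum /=; apply: eq_bigr => i _; rewrite linearZr_LR /= linearZ /=.
rewrite {1}(dual_vect_expansion phi) linear_sumlz (bigD1 i) //=.
rewrite big1 ?addr0 => [|j ji]; last first.
  rewrite linearZl_LR /= -[dotE _ _]/(inner dotE _ _) dotE_dual eq_sym.
  by rewrite (negPf ji) mulr0.
rewrite linearZl_LR /= -[dotE _ _]/(inner dotE _ _) dotE_dual eqxx mulr1n.
rewrite rmorphM /= conjK_of_real conjK_involutive -tnth_nth.
rewrite -mulrA; congr (_ * _).
by rewrite mulrCA [of_real _^-1 * _]mulrC of_realMV mulr1.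
Qed.

End AntilinearIsomorphism.

(** * Events defined by a random subset *)

Section RandomSubset.
Variables (R : realType) (d : measure_display) (Om : measurableType d).
Variables (P : probability Om R) (s : nat) (X : Om -> {set 'I_s}).
Hypothesis X_measurable : forall J, measurable [set w | X w = J]%classic.

Lemma measurable_random_subset (Q : pred {set 'I_s}) :
  measurable [set w | Q (X w)]%classic.
Proof.
rewrite (_ : mkset _ =
  \bigcup_(J in [set J | Q J]%classic) [set w | X w = J])%classic.
  by apply: fin_bigcup_measurable => //; exact: finite_finset.
by apply/seteqP; split => w /= => [QX|[J QJ ->//]]; exists (X w).
Qed.

(** The two events differ by those where [X] strictly contains [T], which are covered by the
    finitely many null events indexed by [i] outside [T]. *)
Lemma probability_eq_subset (T : {set 'I_s}) :
  (forall i, i \notin T -> fine (P [set w | i |: T \subset X w]%classic) = 0) ->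
  P [set w | X w = T]%classic = P [set w | T \subset X w]%classic.
Proof.
move=> null.
have -> : ([set w | T \subset X w] =
           [set w | X w = T] `|` [set w | T \proper X w])%classic.
  apply/seteqP; split => w /=.
    rewrite properE; case: (boolP (X w \subset T)) => [XT TX|_ TX]; last first.
      by right; rewrite TX.
    by left; apply/eqP; rewrite finset.eqEsubset XT.
  by case=> [->|/proper_sub] //; exact: subxx.
have mproper := measurable_random_subset (fun J => T \proper J).
apply/esym/measureU0 => //; apply/negligibleP => //.
apply: (@negligibleS _ _ _ _
  (\big[setU/set0]_(i | i \notin T) [set w | i |: T \subset X w])%classic).
  move=> w /= /properP[TX [i iX iT]]; rewrite (bigD1 i iT) /=; left.
  by rewrite /= finset.subUset finset.sub1set iX.
elim/big_ind: _ => [|A B|i iT]; [exact: negligible_set0|exact: negligibleU|].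
have miT := measurable_random_subset (fun J => i |: T \subset J).
(* [fine] also sends infinite values to 0, so finiteness of the measure is what turns a zero [fine]
   into a null event. *)
by apply/negligibleP => //; rewrite -[LHS]fineK ?null // fin_num_measure.
Qed.

End RandomSubset.

(** * Principal minors of the projection on the image of the transpose *)

Section DeterminantFormula.
Variables (R : realType) (k : field_kind) (s : nat).
Local Notation K := (scalars R k).
Variables (E F : vectType K) (e : s.-tuple E) (del : 'Hom(E, F)).
Variables (x : 'I_s -> R) (dotE : {dot dual E for (@conjK R k)}).
Hypotheses (e_basis : basis_of fullv e) (x_gt0 : forall i, 0 < x i).
Hypothesis dotE_dual : forall i j,
  inner dotE (dual_vect e i) (dual_vect e j) = of_real (x i) *+ (i == j).
Variable T : {set 'I_s}.
Hypothesis T_basis : matroid_basis e del T.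

Local Notation J := (Jx e x).
Local Notation b := (normalized_dual_basis e x).
Local Notation H := (limg (transpose del)).
Local Notation M := (coord_mx b (orth_proj dotE H)).

Let z (l : 'I_#|~: T|) : E := kernel_proj e del T (tnth e (enum_val l)).

Let b_basis : basis_of fullv b.
Proof. by have [] := normalized_dual_basisP e_basis x_gt0 dotE_dual. Qed.

Lemma transpose_ker v phi : v \in lker del -> phi \in H -> phi v = 0.
Proof.
rewrite memv_ker => /eqP dv /memv_imgP[psi _ ->].
by rewrite lfunE /= comp_lfunE dv linear0.
Qed.

Lemma orthov_transpose phi : phi \in orthov dotE H ->
  exists c : 'I_#|~: T| -> K, phi = \sum_l c l *: J (z l).
Proof.
move=> /mem_orthovP phiH.
set v := \sum_i (conjK (phi (tnth e i)) * of_real (x i)) *: tnth e i.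
have Jv : J v = phi by exact: Jx_surj.
have vZ : v \in lker del.
  rewrite memv_ker; apply/eqP.
  (* The product of [J v] with the transpose of [psi] is [psi (del v)]; once every functional
     vanishes at [del v], the coordinate functionals give [del v = 0]. *)
  have dv (psi : dual F) : psi (del v) = 0.
    have := phiH (transpose del psi) (memv_img _ (memvf _)).
    rewrite -Jv => orth.
    have := inner_Jx e_basis x_gt0 dotE_dual v (transpose del psi).
    rewrite /inner.
    have -> : dotE (transpose del psi) (J v) = 0.
      by apply/eqP; rewrite herm_eq0C orth.
    by rewrite lfunE /= comp_lfunE => <-.
  rewrite (coord_vbasis (memvf (del v))) big1 // => i _.
  have := dv (linfun (coord (vbasis fullv) i : F -> K^o)).
  by rewrite lfunE /= => ->; rewrite scale0r.
exists (fun l => conjK (coord e (enum_val l) v)).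
by rewrite -Jx_sum -(kernel_expansion e_basis T_basis).
Qed.

Let G : 'M[K]_(s, #|~: T|) := \matrix_(i, l) coord b i (J (z l)).
(** The adjoint of [G], as [b] is orthonormal. In this form, row [l] applied to the coordinates of a
    functional gives its product with [J (z l)], that is, its value at [z l]. *)
Let Gs : 'M[K]_(#|~: T|, s) := \matrix_(l, i) inner dotE (J (z l)) (tnth b i).

(** Column [j] of the left side holds the coordinates of the component of [b_j] orthogonal to [H], a
    combination of the [J (z l)]. *)
Let sub1_coord_mx : exists C, 1%:M - M = G *m C.
Proof.
have /= Cj j := cid (orthov_transpose (sub_orth_proj dotE H (tnth b j))).
exists (\matrix_(l, j) sval (Cj j) l); apply/matrixP => i j.
rewrite !mxE -(coord_tnth b_basis) -linearB /= (svalP (Cj j)) linear_sum.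
by apply: eq_bigr => l _; rewrite !mxE linearZ mulrC.
Qed.

Let mul_Gs n (p : 'M[K]_(s, n)) (f : 'I_n -> dual E) l j :
  (forall i j, p i j = coord b i (f j)) -> (Gs *m p) l j = f j (z l).
Proof.
move=> pE; rewrite -(inner_Jx e_basis x_gt0 dotE_dual).
rewrite (inner_expansion dotE b_basis) mxE.
by apply: eq_bigr => i _; rewrite !mxE pE mulrC.
Qed.

(** Each entry is the value at a kernel vector [z l] of a functional in the image of the
    transpose. *)
Let mul_Gs_coord_mx : Gs *m M = 0.
Proof.
apply/matrixP => l j.
rewrite (mul_Gs (f := fun j => orth_proj dotE H (tnth b j))) => [|i j'].
  rewrite [RHS]mxE.
  exact: transpose_ker (kernel_proj_ker _ _ _ _) (orth_proj_mem _ _ _).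
by rewrite mxE.
Qed.

Let Gs_E l i : Gs l i = of_real (Num.sqrt (x i))^-1 * coord e i (z l).
Proof. by rewrite mxE inner_Jx // tnth_mktuple scale_lfunE dual_vectE. Qed.

Let coord_z l i : i \notin T -> coord e i (z l) = (i == enum_val l)%:R.
Proof.
by move=> iT; rewrite (coord_kernel_proj e_basis T_basis) // coord_tnth.
Qed.

Let enum_valCP (l : 'I_#|~: T|) : enum_val l \notin T.
Proof. by have := enum_valP l; rewrite inE. Qed.

Let basis_sqnormE :
  basis_sqnorm e x dotE (kernel_basis e del T) = \det (Gs *m G).
Proof.
rewrite /basis_sqnorm.
have Bnth (l : 'I_#|~: T|) : (kernel_basis e del T)`_l = z l.
  rewrite (nth_map (enum_val l)) -?cardE //.
  by rewrite /z [in RHS](enum_val_nth (enum_val l)).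
have sz : size (kernel_basis e del T) = #|~: T| by rewrite size_map -cardE.
rewrite sz; congr (\det _); apply/matrixP => i j.
rewrite (mul_Gs (f := fun j => J (z j))) => [|l j']; last by rewrite mxE.
by rewrite mxE !Bnth inner_Jx.
Qed.

Let det_Gs_G :
  \det (colsub (fun i : 'I_#|~: T| => enum_val i) Gs *m
        rowsub (fun i : 'I_#|~: T| => enum_val i) G) =
  of_real (weight x (~: T))^-1.
Proof.
pose D : 'rV[K]_#|~: T| := \row_l of_real (Num.sqrt (x (enum_val l)))^-1.
have -> : colsub (fun i : 'I_#|~: T| => enum_val i) Gs = diag_mx D.
  apply/matrixP => l i; rewrite mxE Gs_E coord_z // !mxE (inj_eq enum_val_inj).
  by rewrite eq_sym; case: eqP => [->|_]; rewrite ?mulr1 ?mulr0.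
have -> : rowsub (fun i : 'I_#|~: T| => enum_val i) G = diag_mx D.
  apply/matrixP => i l; rewrite !mxE coord_Jx // coord_z //.
  rewrite (inj_eq enum_val_inj).
  by case: eqP => [->|_]; rewrite ?rmorph1 ?rmorph0 ?mul1r ?mul0r.
rewrite det_mulmx det_diag -big_split /weight /= rmorphV ?unitfE; last first.
  by apply/prodf_neq0 => i _; rewrite gt_eqF.
rewrite rmorph_prod -prodfV [RHS]big_enum_val; apply: eq_bigr => l _.
by rewrite !mxE -rmorphM -invfM -expr2 sqr_sqrtr ?fmorphV // ltW.
Qed.

Lemma det_coord_mx_basis :
  \det (principal_submx M T) =
  of_real (weight x (~: T))^-1 / basis_sqnorm e x dotE (kernel_basis e del T).
Proof.
have [C MGC] := sub1_coord_mx.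
have := det_gram_mul_det_projection T MGC mul_Gs_coord_mx.
rewrite det_Gs_G -basis_sqnormE => NM; rewrite -NM mulrAC divff ?mul1r //.
(* The Gram determinant is nonzero by the identity itself: otherwise the inverse weight would
   vanish. *)
apply: contraTneq isT => N0; move: NM; rewrite N0 mul0r => /esym/eqP.
rewrite fmorph_eq0 invr_eq0 => /eqP w0.
suff : weight x (~: T) != 0 by rewrite w0 eqxx.
by apply/prodf_neq0 => i _; rewrite gt_eqF.
Qed.

Lemma det_coord_mx_setU1 i :
  i \notin T -> \det (principal_submx M (i |: T)) = 0.
Proof.
move=> iT; have iTC : i \in ~: T by rewrite inE.
have iU : i \in i |: T by rewrite setU11.
pose l := enum_rank_in iTC i.
have li : enum_val l = i by rewrite enum_rankK_in.
(* The witness is row [l] of [Gs] cut down to [i |: T]. Its entry at [i] is [x_i^(-1/2)], and the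
   cut loses nothing because the row vanishes off [i |: T]. *)
apply/eqP/det0P; exists (\row_a Gs l (enum_val (a : 'I_#|i |: T|))).
  apply/eqP => /rowP/(_ (enum_rank_in iU i)).
  rewrite [LHS]mxE [RHS]mxE enum_rankK_in // Gs_E coord_z // li eqxx.
  move=> /eqP; rewrite mulr1 fmorph_eq0.
  by rewrite invr_eq0 sqrtr_eq0 leNgt x_gt0.
apply/rowP => a; rewrite !mxE.
have /matrixP/(_ l (enum_val a)) := mul_Gs_coord_mx.
rewrite !mxE (sum_set_enum_val (i |: T)) [X in _ + X]big1 ?addr0 => [GsM0|c _].
  by rewrite -[RHS]GsM0; apply: eq_bigr => c _; rewrite !mxE.
have := enum_valP c; rewrite !inE negb_or => /andP[ci cT].
by rewrite Gs_E coord_z // li (negPf ci) mulr0 mul0r.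
Qed.

End DeterminantFormula.

Theorem proposition13p6 (R : realType) (k : field_kind) (s : nat)
    (E F : vectType (scalars R k)) (e : s.-tuple E)
    (e_basis : basis_of fullv e) (del : 'Hom(E, F))
    (dotE : {dot dual E for (@conjK R k)})
    (dotF : {dot dual F for (@conjK R k)})
    (x : 'I_s -> R) (x_gt0 : forall i, 0 < x i)
    (dotE_dual_basis : forall i j : 'I_s,
       inner dotE (dual_vect e i) (dual_vect e j) = of_real (x i) *+ (i == j))
    (d : measure_display) (Om : measurableType d) (P : probability Om R)
    (X : Om -> {set 'I_s})
    (X_determinantal : determinantal dotE P (normalized_dual_basis e x)
                         (limg (transpose del)) X)
    (T : {set 'I_s}) (T_basis : matroid_basis e del T) :
  of_real (fine (P [set w | X w = T]%classic)) =
  of_real (weight x (~: T))^-1 / basis_sqnorm e x dotE (kernel_basis e del T).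
Proof.
have [X_measurable X_det] := X_determinantal.
rewrite probability_eq_subset // => [|i iT].
  by rewrite X_det (det_coord_mx_basis e_basis).
(* The minors live in the base field, so the vanishing of a real probability is read off through the
   injective [of_real]. *)
apply/eqP; rewrite -(fmorph_eq0 (@of_real R k)); apply/eqP.
by rewrite /= X_det (det_coord_mx_setU1 e_basis x_gt0 dotE_dual_basis T_basis).
Qed.
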